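(* Let $X$ be a descended operational core (a set with truncations $\bar r_t$), let $\mathfrak R=(R_\alpha)_{\alpha\in A}$ be a causally calibrated response program on $X$, and let $\mathfrak R^+$ be obtained from $\mathfrak R$ by adjoining a family of causally equivariant responses $S_\beta^\circ:X\to\mathsf T_\beta$, $\beta\in B$, into complete Hausdorff causal uniform spaces. Write $\mathsf Z_{\mathfrak R}$ and $\mathsf Z_{\mathfrak R^+}$ for the corresponding response completions. (i) If some $S_\beta^\circ$ is not constant on $\mathfrak R$-response classes, then the enlarged program strictly refines the response quotient (before any completion). (ii) Suppose every $S_\beta^\circ$ descends to the $\mathfrak R$-response quotient. Then the enlarged and original response congruences coincide, and the identity on the common quotient is uniformly continuous from the refined response uniformity to the original one. It therefore extends uniquely to a stable-causal map $\Pi_{\mathfrak R^+,\mathfrak R}:\mathsf Z_{\mathfrak R^+}\to\mathsf Z_{\mathfrak R}$ with dense range. (iii) Under the hypothesis of (ii), the following are equivalent: (a) every added response $S_\beta^\circ$ is uniformly continuous for the $\mathfrak R$-generated uniformity; (b) the original and enlarged response-generated uniformities coincide; (c) the map $\Pi_{\mathfrak R^+,\mathfrak R}$ is the unique uniform isomorphism of the two completions (compatible with the common core), and every $S_\beta^\circ$ extends uniquely as a stable-causal readout of $\mathsf Z_{\mathfrak R}$. (iv) If one descended added response is not uniformly continuous for the $\mathfrak R$-generated uniformity, it has no uniformly continuous extension to $\mathsf Z_{\mathfrak R}$ as a response of the declared calibrated program; retaining it requires the refined completion $\mathsf Z_{\mathfrak R^+}$. In a metrizable presentation the failure is witnessed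 by pairs $x_n,y_n\in X$ whose old response distance tends to zero while the added-response distance stays bounded away from zero.
   Context: Time runs over $[0,T]$, $0<T<\infty$. Truncations are maps $\rho_t$ with $\rho_T=I$, $\rho_s\rho_t=\rho_{s\wedge t}$. A causal uniform space is a Hausdorff uniform space with uniformly continuous truncations. A stable-causal map between causal uniform spaces is a uniformly continuous map $R:\mathsf S\to\mathsf T$ with $\rho_t^{\mathsf T}R=\rho_t^{\mathsf T}R\rho_t^{\mathsf S}$ for all $t$; a stable-causal readout is such a map used to extract one object from another. A causally calibrated response program on $X$ is a family of maps $R_\alpha:X\to\mathsf Y_\alpha$ into complete Hausdorff causal uniform spaces that is causally equivariant: $R_\alpha(\bar r_tu)=\rho_t^\alpha R_\alpha(u)$. Two points are in the same $\mathfrak R$-response class (response congruence) if all $R_\alpha$ agree on them; the response quotient carries the initial uniformity generated by the induced responses (the $\mathfrak R$-generated, or response-generated, uniformity). The response completion $\mathsf Z_{\mathfrak R}$ is the closure of the image of the joint profile $x\mapsto(R_\alpha(x))_\alpha$ in $\prod_\alpha\mathsf Y_\alpha$ with the subspace uniformity and the inherited coordinatewise truncations; the response quotient is identified with a dense subset of it. A response ''descends'' if it is constant on response classes. *)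

(* Defs.v *)
From HB Require Import structures.
From mathcomp Require Import all_boot all_order all_algebra finmap.
From mathcomp Require Import all_classical all_reals all_analysis.

Set Implicit Arguments.
Unset Strict Implicit.
Unset Printing Implicit Defensive.

Import Order.TTheory GRing.Theory Num.Theory.
Import numFieldNormedType.Exports.

Local Open Scope classical_set_scope.
Local Open Scope ring_scope.
Local Open Scope quotient_scope.

(* The library's [completeType] is pointed; this version allows empty spaces. *)
Definition complete_uniform (U : uniformType) : Prop :=
  forall F : set_system U, ProperFilter F -> cauchy F -> exists l : U, F --> l.

Section sup_entourage.
Context (V : choiceType) (I : Type) (Vc : I -> Uniform V).

Lemma sup_ent_component (i : I) (E : set (V * V)) :
  @entourage (Uniform.Pack (Vc i)) E -> @entourage (sup_topology Vc) E.
Proof.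
move=> entE.
pose P (p : {classic I} * set (V * V)) :=
  `[< @entourage (Uniform.Pack (Vc p.1)) p.2 >].
have PE : P ((i : {classic I}), E) by exact/asboolP.
exists E => //.
exists [fset (exist (fun p => P p) _ PE : {p : {classic I} * set (V * V) | P p})]%fset.
  by move=> ? _; exact: in_setT.
by rewrite set_fset1 bigcap_set1.
Qed.

Lemma sup_ent_sub (F : set_system (V * V)) : Filter F ->
  (forall i E, @entourage (Uniform.Pack (Vc i)) E -> F E) ->
  forall E, @entourage (sup_topology Vc) E -> F E.
Proof.
move=> FF FV E [_ [J _ <-] JE]; apply: filterS JE _.
by apply: filter_bigI => -[[i D] /= iD] _; exact: FV (asboolW iD).
Qed.

End sup_entourage.

Lemma unif_continuous_continuous (U V : uniformType) (f : U -> V) :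
  unif_continuous f -> continuous f.
Proof.
move=> uf x A /nbhsP[E entE EA]; apply/nbhsP; exists (fun p => E (f p.1, f p.2)).
  exact: uf.
by move=> y /xsectionP/= Ey; apply: EA; apply/xsectionP.
Qed.

Lemma prod_ent_component (I : Type) (V : I -> uniformType) (i : I)
    (E : set (V i * V i)) : entourage E ->
  @entourage (prod_topology V) (fun p => E (p.1 i, p.2 i)).
Proof.
move=> entE.
have iE : @initial_ent _ _ (@proj _ V i) (fun p => E (p.1 i, p.2 i)).
  by exists E => // -[].
exact: (@sup_ent_component _ _
  (fun i => Uniform.class (initial_topology (@proj _ V i))) i _ iE).
Qed.

Lemma prod_ent_sub (I : Type) (V : I -> uniformType)
    (F : set_system (prod_topology V * prod_topology V)) : Filter F ->
  (forall i E, @entourage (V i) E -> F (fun p => E (p.1 i, p.2 i))) ->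
  forall E, @entourage (prod_topology V) E -> F E.
Proof.
move=> FF FV; apply: (@sup_ent_sub _ _
  (fun i => Uniform.class (initial_topology (@proj _ V i)))) => i D [D' entD' DD'].
by apply: filterS (FV i D' entD') => -[x y]; exact: DD'.
Qed.

Lemma prod_proj_unif (I : Type) (V : I -> uniformType) (i : I) :
  unif_continuous (fun z : prod_topology V => z i).
Proof. by move=> E; exact: prod_ent_component. Qed.

Lemma unif_hausdorff_inj (U V : uniformType) (f : U -> V) (p q : U) :
  hausdorff_space V -> unif_continuous f -> cluster (nbhs p) q -> f p = f q.
Proof.
move=> hV /unif_continuous_continuous cf pq; apply: hV => A B fpA fqB.
by have [z [zA zB]] := pq _ _ (cf p A fpA) (cf q B fqB); exists (f z).
Qed.

Lemma set_val_unif (U : uniformType) (A : set U) :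
  unif_continuous (set_val : A -> U).
Proof. by move=> E entE; exists E => // -[]. Qed.

(* Truncations are indexed by the whole field; they are constrained (and used)
   only for times in [0, T]. *)
Record causalUniform (K : realType) (T : K) := CausalUniform {
  cu_sort :> uniformType;
  trunc : K -> cu_sort -> cu_sort;
  trunc_horizon : forall u, trunc T u = u;
  trunc_trunc : forall s t, 0 <= s <= T -> 0 <= t <= T ->
    forall u, trunc s (trunc t u) = trunc (Num.min s t) u;
  trunc_unif_continuous : forall t, 0 <= t <= T -> unif_continuous (trunc t);
  cu_hausdorff : hausdorff_space cu_sort
}.

Record causalCore (K : realType) (T : K) := CausalCore {
  core_sort :> choiceType;
  ctrunc : K -> core_sort -> core_sort;
  ctrunc_horizon : forall x, ctrunc T x = x;
  ctrunc_ctrunc : forall s t, 0 <= s <= T -> 0 <= t <= T ->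
    forall x, ctrunc s (ctrunc t x) = ctrunc (Num.min s t) x
}.

Definition stable_causal (K : realType) (T : K) (S S' : causalUniform T)
    (f : S -> S') : Prop :=
  unif_continuous f /\
  forall t, 0 <= t <= T -> forall u, trunc t (f u) = trunc t (f (trunc t u)).

Record responseProgram (K : realType) (T : K) (X : causalCore T) (A : Type) :=
  ResponseProgram {
  cod : A -> causalUniform T;
  cod_complete : forall a, complete_uniform (cod a);
  resp : forall a, X -> cod a;
  resp_equivariant : forall a t, 0 <= t <= T ->
    forall x, resp a (ctrunc t x) = trunc t (resp a x)
}.

Section adjoin.
Context (K : realType) (T : K) (X : causalCore T) (A B : Type).
Variables (R : responseProgram X A) (S : responseProgram X B).

Definition adjoin_cod (i : A + B) : causalUniform T :=
  match i with inl a => cod R a | inr b => cod S b end.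

Definition adjoin_resp (i : A + B) : X -> adjoin_cod i :=
  match i with inl a => @resp _ _ _ _ R a | inr b => @resp _ _ _ _ S b end.

Lemma adjoin_complete i : complete_uniform (adjoin_cod i).
Proof. by case: i => [a|b]; exact: cod_complete. Qed.

Lemma adjoin_equivariant i t : 0 <= t <= T ->
  forall x, adjoin_resp i (ctrunc t x) = trunc t (adjoin_resp i x).
Proof. by case: i => [a|b]; exact: resp_equivariant. Qed.

Definition adjoin : responseProgram X (A + B) :=
  ResponseProgram adjoin_complete adjoin_equivariant.

End adjoin.

Section response.
Context (K : realType) (T : K) (X : causalCore T) (A : Type).
Variable R : responseProgram X A.

Definition resp_congr (x y : X) : Prop := forall a, resp R a x = resp R a y.

Definition descends (U : Type) (f : X -> U) : Prop :=
  forall x y, resp_congr x y -> f x = f y.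

Definition resp_congrb : rel X := fun x y => `[< resp_congr x y >].

Lemma resp_congrb_equiv : equiv_class_of resp_congrb.
Proof.
split=> [x|x y|y x z].
- by apply/asboolP.
- by apply/idP/idP => /asboolP xy; apply/asboolP => a; rewrite xy.
- by move=> /asboolP xy /asboolP yz; apply/asboolP => a; rewrite xy yz.
Qed.

Canonical resp_equiv := EquivRelPack resp_congrb_equiv.

Definition respClasses : choiceType := {eq_quot resp_equiv}.

(* Meaningful when [f] descends, see [descended_cls]. *)
Definition descended (U : Type) (f : X -> U) : respClasses -> U :=
  fun q => f (repr q).

(* Carries the R-generated uniformity: the supremum of the uniformities initial
   for each induced response. *)
Definition respQuot : Type := respClasses.

HB.instance Definition _ := Uniform.copy respQuot
  (sup_topology (fun a =>
     Uniform.class (initial_topology (descended (@resp _ _ _ _ R a))))).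

Definition cls (x : X) : respQuot := \pi_({eq_quot resp_equiv}) x.

Lemma cls_eq (x y : X) : cls x = cls y <-> resp_congr x y.
Proof.
by split=> [/eqmodP/asboolP//|xy]; apply/eqmodP/asboolP.
Qed.

Lemma descended_cls (U : Type) (f : X -> U) (x : X) :
  descends f -> descended f (cls x) = f x.
Proof. by apply; apply/cls_eq; rewrite /cls reprK. Qed.

Definition codU (a : A) : uniformType := cod R a.

Definition profile (x : X) : prod_topology codU := fun a => resp R a x.

Definition completion_set : set (prod_topology codU) :=
  closure (range profile).

Definition prod_trunc (t : K) (z : prod_topology codU) : prod_topology codU :=
  fun a => @trunc _ _ (cod R a) t (z a).

Lemma prod_trunc_unif (t : K) : 0 <= t <= T -> unif_continuous (prod_trunc t).
Proof.
move=> tT; apply: prod_ent_sub => a E entE.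
exact: (prod_ent_component (V := codU) (trunc_unif_continuous tT entE)).
Qed.

Lemma prod_trunc_profile (t : K) (x : X) : 0 <= t <= T ->
  prod_trunc t (profile x) = profile (ctrunc t x).
Proof.
by move=> tT; apply: functional_extensionality_dep => a;
   rewrite /profile resp_equivariant.
Qed.

Lemma prod_trunc_completion (t : K) (z : prod_topology codU) : 0 <= t <= T ->
  completion_set z -> completion_set (prod_trunc t z).
Proof.
move=> tT zR N.
move/(unif_continuous_continuous (prod_trunc_unif tT))/zR => [_ [[x _ <-] Nx]].
exists (profile (ctrunc t x)); split; first by exists (ctrunc t x).
by move: Nx; rewrite /preimage/= prod_trunc_profile.
Qed.

(* Outside [0, T] the truncation is set to the identity. *)
Definition completion_trunc (t : K) (z : completion_set) : completion_set :=
  match pselect (0 <= t <= T) with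
  | left tT =>
      SigSub (mem_set (prod_trunc_completion tT (set_mem (valP z))))
  | right _ => z
  end.

Lemma completion_truncE (t : K) (z : completion_set) : 0 <= t <= T ->
  \val (completion_trunc t z) = prod_trunc t (\val z).
Proof. by move=> tT; rewrite /completion_trunc; case: pselect. Qed.

Lemma completion_trunc_horizon (z : completion_set) : completion_trunc T z = z.
Proof.
rewrite /completion_trunc; case: pselect => // TT; apply: val_inj => /=.
by apply: functional_extensionality_dep => a; exact: trunc_horizon.
Qed.

Lemma completion_trunc_trunc (s t : K) : 0 <= s <= T -> 0 <= t <= T ->
  forall z : completion_set,
  completion_trunc s (completion_trunc t z) = completion_trunc (Num.min s t) z.
Proof.
move=> sT tT z; have stT : 0 <= Num.min s t <= T by case: (ltP s t).
apply: val_inj; rewrite !completion_truncE//.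
by apply: functional_extensionality_dep => a; exact: trunc_trunc.
Qed.

Lemma completion_trunc_unif (t : K) : 0 <= t <= T ->
  unif_continuous (completion_trunc t).
Proof.
move=> tT E [D entD DE].
exists (fun p => D (prod_trunc t p.1, prod_trunc t p.2)).
  exact: (prod_trunc_unif tT).
move=> -[u v] /= Duv; apply: DE => /=.
have valE z : set_val (completion_trunc t z) = prod_trunc t (set_val z).
  exact: completion_truncE.
by rewrite /unstable.map_pair/= !valE.
Qed.

Lemma completion_hausdorff : hausdorff_space completion_set.
Proof.
move=> p q pq; apply: val_inj; apply: functional_extensionality_dep => a.
apply: (@unif_hausdorff_inj _ _ (fun z : completion_set => set_val z a)) pq.
  exact: (@cu_hausdorff _ _ (cod R a)).
by move=> E /(@prod_proj_unif _ codU a); exact: set_val_unif.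
Qed.

(* The response completion: closure of the image of the joint profile in the
   product, with the subspace uniformity and the coordinatewise truncations. *)
Definition completion : causalUniform T :=
  @CausalUniform K T completion_set completion_trunc completion_trunc_horizon
    completion_trunc_trunc completion_trunc_unif completion_hausdorff.

Definition quot_embed (q : respQuot) : completion :=
  SigSub (mem_set (subset_closure (imageT profile (repr q)))).

Lemma quot_embedE (x : X) : \val (quot_embed (cls x)) = profile x.
Proof.
apply: functional_extensionality_dep => a.
by apply: (@descended_cls _ (resp R a)) => y z; exact.
Qed.

End response.

Arguments descended {K T X A} R {U} f q.

Definition strictly_refines (K : realType) (T : K) (X : causalCore T)
    (A' A : Type) (R' : responseProgram X A') (R : responseProgram X A) : Prop :=
  (forall x y, resp_congr R' x y -> resp_congr R x y) /\
  (exists x y, resp_congr R x y /\ ~ resp_congr R' x y).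

(* The canonical map between the quotients of two programs on the same core;
   meaningful when the congruence of [R'] is contained in that of [R]. *)
Definition quot_map (K : realType) (T : K) (X : causalCore T) (A' A : Type)
    (R' : responseProgram X A') (R : responseProgram X A) :
    respQuot R' -> respQuot R :=
  fun q => cls R (repr q).
Arguments quot_map {K T X A' A} R' R q.

(* [f] extends the canonical map of the quotients to the completions. *)
Definition extends_quot_map (K : realType) (T : K) (X : causalCore T)
    (A' A : Type) (R' : responseProgram X A') (R : responseProgram X A)
    (f : completion R' -> completion R) : Prop :=
  forall q : respQuot R', f (quot_embed q) = quot_embed (quot_map R' R q).

Definition uniform_iso (U V : uniformType) (f : U -> V) : Prop :=
  unif_continuous f /\
  exists g : V -> U, [/\ cancel f g, cancel g f & unif_continuous g].

Definition metric_for (K : realType) (U : uniformType) (d : U -> U -> K) : Prop :=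
  [/\ forall u v, d u v = 0 <-> u = v,
      forall u v, d u v = d v u,
      forall u v w, d u w <= d u v + d v w &
      entourage = entourage_ (fun u e => [set v | d u v < e])].

(* Main.v *)
Require Import Defs.
From mathcomp Require Import all_boot all_order all_algebra.
From mathcomp Require Import all_classical all_reals all_analysis.

Set Implicit Arguments.
Unset Strict Implicit.
Unset Printing Implicit Defensive.

Import Order.TTheory GRing.Theory Num.Theory.
Import numFieldNormedType.Exports.

Local Open Scope classical_set_scope.
Local Open Scope ring_scope.

(** The proof rests on the universal property of the response completion
    ([completion_universal]).  If the core has dense, equivariant image in a
    causal uniform space W, and every response factors through a uniformly
    continuous map on W, then the tuple of these maps sends W into the closure
    of the profiles, because it does so on a dense set.  So W maps to the
    completion, uniquely, since a map into a Hausdorff space is determined by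
    its values on a dense set ([eq_on_dense_range]).  Stability of the map under
    truncation holds because both sides of the required identity are continuous
    and agree on the core, where the identity is equivariance
    ([equivariant_stable_causal]).

    The comparison map Pi is this property for W the enlarged completion, whose
    coordinates contain the old ones.  Conversely, once every added response is
    uniformly continuous for the old uniformity, it extends to the old
    completion because its target is complete ([readout_extension]); the old
    completion then carries all the responses of the enlarged program, and the
    same property with the two completions exchanged gives the inverse of Pi
    ([comparison_map_iso]).  The same property, for arbitrary W, says that
    the enlarged completion is minimal among the spaces retaining all the
    responses.

    The equivalence with equality of uniformities is initiality of the
    response-generated uniformity: a map into a response quotient is uniformly
    continuous as soon as its composites with the responses are.  In the
    other direction, a uniformly continuous extension of an added response to
    the old completion restricts to a uniformly continuous map on the quotient,
    and an isomorphism of the completions supplies such an extension by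
    transporting a coordinate of the enlarged completion; hence a response that
    is not uniformly continuous excludes both.  The witnessing sequences negate
    uniform continuity at the scales 1/(n+1). *)

(** * Extension of maps from a dense subset *)

Lemma unif_continuous_comp (U V W : uniformType) (f : U -> V) (g : V -> W) :
  unif_continuous f -> unif_continuous g -> unif_continuous (g \o f).
Proof. by move=> uf ug E /ug; exact: uf. Qed.

(** The trace on Q of the neighbourhoods of c: along it one takes limits at c of
    maps that are only known on Q. *)
Lemma dense_range_filter (Q : Type) (C : topologicalType) (e : Q -> C) (c : C) :
  dense (range e) -> ProperFilter (filter_from (nbhs c) (preimage e)).
Proof.
move=> de; apply: filter_from_proper.
  apply: filter_from_filter; first by exists setT; exact: filterT.
  by move=> M N cM cN; exists (M `&` N) => //; exact: filterI.
move=> N /nbhs_interior cN.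
have [||y [/interior_subset Ny [q _ qE]]] := de (interior N).
- by exists c; exact: nbhs_singleton.
- exact: open_interior.
- by exists q; rewrite /preimage/= qE.
Qed.

Lemma eq_on_dense_range (Q : Type) (C Y : topologicalType) (e : Q -> C)
    (f g : C -> Y) : hausdorff_space Y -> dense (range e) ->
  continuous f -> continuous g -> (forall q, f (e q) = g (e q)) -> f = g.
Proof.
move=> hY de cf cg fg; apply/funext => c.
have PF := dense_range_filter c de.
have lim h : continuous h ->
    (h \o e) @ filter_from (nbhs c) (preimage e) --> h c.
  by move=> ch N /ch cN; exists (h @^-1` N).
apply: (@cvg_unique _ hY ((f \o e) @ filter_from (nbhs c) (preimage e)) _);
  first exact: lim.
by rewrite (_ : f \o e = g \o e); [exact: lim | exact/funext].
Qed.

(** The hypothesis on f is uniform continuity for the uniformity that e induces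
    on Q, expressed without putting a uniformity on the bare type Q.  The
    value at c is the limit of f along the trace of the neighbourhoods of c, a
    Cauchy filter. *)
Lemma dense_unif_extension (Q : Type) (C Y : uniformType) (e : Q -> C)
    (f : Q -> Y) : dense (range e) -> complete_uniform Y -> hausdorff_space Y ->
  (forall E, @entourage Y E -> exists2 D, @entourage C D &
     forall p q, D (e p, e q) -> E (f p, f q)) ->
  exists g : C -> Y, unif_continuous g /\ forall q, g (e q) = f q.
Proof.
move=> de cY hY uf.
pose tr (c : C) := filter_from (nbhs c) (preimage e).
have trP c : ProperFilter (tr c) by exact: dense_range_filter.
have near c D : entourage D -> tr c (fun q => D (c, e q)).
  move=> entD; exists (xsection D c); first exact: nbhs_entourage.
  by move=> q /xsectionP.
have ca c : cauchy (f @ tr c).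
  move=> E /uf[D entD fD].
  have [D1 entD1 D1D] := entourage_split_ex entD.
  exists (f @` (fun q => (D1 `&` (D1^-1)%relation) (c, e q)),
          f @` (fun q => (D1 `&` (D1^-1)%relation) (c, e q))).
    by split; apply: filterS (near c _ (entourage_invI entD1)) => q Dq; exists q.
  move=> [_ _] /= [[p [_ pc] <-] [q [cq _] <-]].
  by apply: fD; apply: D1D; exists c.
have /choice[g gP] : forall c, exists l : Y, f @ tr c --> l.
  by move=> c; exact: (cY (f @ tr c)) (ca c).
have gf E c : entourage E -> tr c (fun q => E (g c, f q)).
  by move=> entE; move/cvg_entourageP: (gP c); exact.
exists g; split.
  move=> E entE.
  (* From g c to g c' one passes through f p and f q, with e p near c and e q
     near c': three small steps in Y, and three in C from e p to e q. *)
  have [E1 entE1 E1E] := entourage_split_ex entE.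
  have [E2 entE2 E2E1] := entourage_split_ex entE1.
  have [D entD fD] := uf _ entE2.
  have [D1 entD1 D1D] := entourage_split_ex entD.
  have [D2 entD2 D2D1] := entourage_split_ex entD1.
  have D2D3 := entourage_invI entD2.
  apply: filterS (entD2) => -[c c'] /= D2cc'.
  have [p [gp [_ pc]]] := filter_ex (filterI (gf _ c entE2) (near c _ D2D3)).
  have [q [gq [cq _]]] := filter_ex (filterI
    (gf _ c' (entourage_inv entE2)) (near c' _ D2D3)).
  apply: E1E; exists (f q); last first.
    apply: E2E1; exists (g c'); [exact: gq|exact: entourage_refl].
  apply: E2E1; exists (f p) => //; apply: fD; apply: D1D; exists c'.
    by apply: D2D1; exists c.
  by apply: D2D1; exists c'; [exact: entourage_refl|exact: cq].
move=> q; apply: (@cvg_unique _ hY (f @ tr (e q)) _); first exact: gP.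
apply/cvg_entourageP => E /uf[D entD fD].
by apply: filterS (near _ _ entD) => p; exact: fD.
Qed.

(** * The response quotient inside its completion *)

Section completion_theory.
Context (K : realType) (T : K) (X : causalCore T) (A : Type).
Variable R : responseProgram X A.

Lemma resp_descends (a : A) : descends R (resp R a).
Proof. by move=> x y; exact. Qed.

Lemma cls_surj (q : respQuot R) : exists x, cls R x = q.
Proof. by exists (repr q); exact: reprK. Qed.

Lemma descended_resp_unif (a : A) :
  unif_continuous (descended R (resp R a) : respQuot R -> cod R a).
Proof.
move=> E entE.
pose r a' := descended R (resp R a') : respClasses R -> codU R a'.
have aE : @initial_ent _ _ (r a) (fun p => E (r a p.1, r a p.2)).
  by exists E => // -[].
exact: (@sup_ent_component _ _
  (fun a' => Uniform.class (initial_topology (r a'))) a _ aE).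
Qed.

(** Initiality of the response-generated uniformity. *)
Lemma respQuot_unif (W : uniformType) (f : W -> respQuot R) :
  (forall a, unif_continuous
     (fun w => descended R (resp R a) (f w) : cod R a)) ->
  unif_continuous f.
Proof.
move=> uf E entE.
pose F := (fun p : W * W => (f p.1, f p.2)) @ (@entourage W).
apply: (@sup_ent_sub _ _
  (fun a => Uniform.class
     (initial_topology (descended R (resp R a) : respClasses R -> codU R a)))
  F _ _ E entE) => a E' [D entD DE].
apply: (@filterS _ (@entourage W) _ _ _ _ (uf a D entD)) => -[u v] Duv.
exact: (DE (f u, f v)).
Qed.

Lemma completion_unif (W : uniformType) (f : W -> completion R) :
  (forall a, unif_continuous (fun w => \val (f w) a : cod R a)) ->
  unif_continuous f.
Proof.
move=> uf E [D entD DE].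
have entfD : @entourage W (fun p => D (\val (f p.1), \val (f p.2))).
  pose F := (fun p : W * W => (\val (f p.1), \val (f p.2))) @ (@entourage W).
  apply: (prod_ent_sub (F := F)) entD => a D' entD'.
  exact: uf.
apply: (@filterS _ (@entourage W) _ _ _ _ entfD) => -[u v] Duv.
exact: (DE (f u, f v)).
Qed.

Lemma quot_embed_unif : unif_continuous (@quot_embed _ _ _ _ R).
Proof. by apply: completion_unif => a; exact: descended_resp_unif. Qed.

Lemma completion_coord_unif (a : A) :
  unif_continuous (fun z : completion R => \val z a : cod R a).
Proof. by move=> E /(@prod_proj_unif _ (codU R) a); exact: set_val_unif. Qed.

(** The uniformity of the quotient is induced from the completion: both are
    generated by the same responses.  This lets uniform continuity on the
    quotient be read as a hypothesis of [dense_unif_extension]. *)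
Lemma quot_embed_initial (E : set (respQuot R * respQuot R)) : entourage E ->
  exists2 D, @entourage (completion R) D &
    forall p q, D (quot_embed p, quot_embed q) -> E (p, q).
Proof.
pose F := @entourage (initial_topology (@quot_embed _ _ _ _ R)).
suff FE : @entourage (respQuot R) `<=` F.
  by move=> /FE[D entD DE]; exists D => // p q Dpq; exact: (DE (p, q)).
have FF : Filter F by exact: entourage_filter'.
move=> E' entE'.
apply: (@sup_ent_sub _ _
  (fun a => Uniform.class
     (initial_topology (descended R (resp R a) : respClasses R -> codU R a)))
  F FF _ E' entE') => a D [D' /(@completion_coord_unif a) entD' D'D].
by exists (fun p => D' (\val p.1 a, \val p.2 a)) => // -[p q]; exact: D'D.
Qed.

Lemma dense_quot_embed : dense (range (fun x => quot_embed (cls R x))).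
Proof.
move=> O [z Oz] oO.
have /nbhsP[E [D entD DE] EO] : nbhs z O by exact: open_nbhs_nbhs.
have [_ [[x _ <-] /xsectionP Dx]] :=
  set_mem (valP z) _ (nbhs_entourage (\val z) entD).
exists (quot_embed (cls R x)); split; last by exists x.
apply: EO; apply/xsectionP; apply: DE.
by move: Dx; rewrite -quot_embedE.
Qed.

End completion_theory.

(** * Universal property of the completion *)

Section universal_property.
Context (K : realType) (T : K) (X : causalCore T).

(** Both sides of the stability identity are continuous in u, so it suffices to
    compare them on the image of j; there it reduces, by equivariance, to
    idempotence of the truncation at t. *)
Lemma equivariant_stable_causal (W S : causalUniform T) (j : X -> W)
    (f : W -> S) : dense (range j) ->
  (forall t, 0 <= t <= T -> forall x, j (ctrunc t x) = trunc t (j x)) ->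
  (forall t, 0 <= t <= T -> forall x, f (j (ctrunc t x)) = trunc t (f (j x))) ->
  unif_continuous f -> stable_causal f.
Proof.
move=> dj jt ft uf; split=> // t tT u.
have ut : unif_continuous (fun u => trunc t (f u)).
  exact: unif_continuous_comp uf (trunc_unif_continuous tT).
have utt : unif_continuous (fun u => trunc t (f (trunc t u))).
  exact: unif_continuous_comp (trunc_unif_continuous tT) ut.
apply: (congr1 (@^~ u) (eq_on_dense_range (@cu_hausdorff _ _ S) dj
  (unif_continuous_continuous ut) (unif_continuous_continuous utt) _)) => x.
by rewrite -jt// ft// trunc_trunc// minxx.
Qed.

Context (A : Type) (R : responseProgram X A).

Lemma quot_embed_equivariant t : 0 <= t <= T -> forall x,
  quot_embed (cls R (ctrunc t x)) = trunc t (quot_embed (cls R x)).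
Proof.
move=> tT x; apply: val_inj.
by rewrite completion_truncE// !quot_embedE prod_trunc_profile.
Qed.

Lemma eq_on_core (S : causalUniform T) (f g : completion R -> S) :
  unif_continuous f -> unif_continuous g ->
  (forall x, f (quot_embed (cls R x)) = g (quot_embed (cls R x))) -> f = g.
Proof.
move=> uf ug; apply: (eq_on_dense_range (@cu_hausdorff _ _ S)
  (@dense_quot_embed _ _ _ _ R)); exact: unif_continuous_continuous.
Qed.

Lemma unif_stable_causal (S : causalUniform T) (f : completion R -> S)
    (s : X -> S) :
  (forall t, 0 <= t <= T -> forall x, s (ctrunc t x) = trunc t (s x)) ->
  (forall x, f (quot_embed (cls R x)) = s x) ->
  unif_continuous f -> stable_causal f.
Proof.
move=> st fs; apply: equivariant_stable_causal (@dense_quot_embed _ _ _ _ R) _ _.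
  exact: quot_embed_equivariant.
by move=> t tT x; rewrite !fs st.
Qed.

Lemma completion_readout (a : A) :
  exists! Sa : completion R -> cod R a, stable_causal Sa /\
    forall x, Sa (quot_embed (cls R x)) = resp R a x.
Proof.
have coordE x : \val (quot_embed (cls R x)) a = resp R a x by rewrite quot_embedE.
exists (fun z => \val z a); split.
  split=> //; apply: (unif_stable_causal _ coordE).
    exact: resp_equivariant.
  exact: completion_coord_unif.
move=> f [[uf _] fE]; apply: eq_on_core => //; first exact: completion_coord_unif.
by move=> x; rewrite fE.
Qed.

(** Completeness of the target is what turns uniform continuity on the quotient
    into an extension to the completion. *)
Lemma readout_extension (S : causalUniform T) (s : X -> S) :
  complete_uniform S ->
  (forall t, 0 <= t <= T -> forall x, s (ctrunc t x) = trunc t (s x)) ->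
  descends R s -> unif_continuous (descended R s : respQuot R -> S) ->
  exists! Sb : completion R -> S, stable_causal Sb /\
    forall x, Sb (quot_embed (cls R x)) = s x.
Proof.
move=> cS st ds us.
have [||g [ug gE]] := @dense_unif_extension X (completion R) S
  (fun x => quot_embed (cls R x)) s (@dense_quot_embed _ _ _ _ R) cS.
- exact: cu_hausdorff.
- move=> E /us /quot_embed_initial[D entD DE]; exists D => // x y /DE /=.
  by rewrite !descended_cls.
exists g; split; first by split=> //; exact: unif_stable_causal gE ug.
by move=> f [[uf _] fE]; apply: eq_on_core => // x; rewrite gE fE.
Qed.

(** The readouts on W assemble into a map to the product.  Its values are limits
    of profiles because the core is dense in W, so it lands in the
    completion. *)
Lemma completion_universal (W : causalUniform T) (j : X -> W) :
  dense (range j) ->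
  (forall t, 0 <= t <= T -> forall x, j (ctrunc t x) = trunc t (j x)) ->
  (forall a, exists g : W -> cod R a,
     unif_continuous g /\ forall x, g (j x) = resp R a x) ->
  exists! h : W -> completion R,
    stable_causal h /\ forall x, h (j x) = quot_embed (cls R x).
Proof.
move=> dj jt gex.
pose g a := projT1 (cid (gex a)).
have ug a : unif_continuous (g a) by rewrite /g; case: cid => ? [].
have gE a x : g a (j x) = resp R a x by rewrite /g; case: cid => ? [].
pose h0 (w : W) : prod_topology (codU R) := fun a => g a w.
have uh0 : unif_continuous h0.
  move=> E entE.
  apply: (prod_ent_sub (F := (fun p : W * W => (h0 p.1, h0 p.2)) @ (@entourage W)))
    entE => a D; exact: ug.
have h0E x : h0 (j x) = profile R x.
  by apply: functional_extensionality_dep => a; exact: gE.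
have h0R w : @completion_set _ _ _ _ R (h0 w).
  move=> N /(unif_continuous_continuous uh0) wN.
  have PF := dense_range_filter w dj.
  have [x Nx] : exists x, N (h0 (j x)).
    by apply: (@filter_ex _ _ PF); exists (h0 @^-1` N).
  by exists (h0 (j x)); split=> //; exists x.
pose h w : completion R := SigSub (mem_set (h0R w)).
have uh : unif_continuous h by apply: completion_unif => a; exact: ug.
have hE x : h (j x) = quot_embed (cls R x).
  by apply: val_inj; rewrite quot_embedE -h0E.
exists h; split.
  split=> //; apply: equivariant_stable_causal dj jt _ uh => t tT x.
  by rewrite !hE quot_embed_equivariant.
move=> f [[uf _] fE]; apply: (eq_on_dense_range (@cu_hausdorff _ _ _) dj).
- exact: unif_continuous_continuous.
- exact: unif_continuous_continuous.
- by move=> x; rewrite hE fE.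
Qed.

End universal_property.

(** * Metric witnesses of failure of uniform continuity *)

Lemma metric_not_unif_continuous (K : realType) (U V : uniformType)
    (dU : U -> U -> K) (dV : V -> V -> K) (f : U -> V) :
  metric_for dU -> metric_for dV -> ~ unif_continuous f ->
  exists u v : nat -> U, (fun n => dU (u n) (v n)) @ \oo --> (0 : K) /\
    exists2 e : K, 0 < e & forall n, e <= dV (f (u n)) (f (v n)).
Proof.
move=> [dU0 dUC dUt entU] [_ _ _ entV] nuf.
have dU_ge0 u v : 0 <= dU u v.
  have := dUt u v u; rewrite (dU0 u u).2// (dUC v u) -mulr2n.
  by rewrite pmulrn_lge0.
have [e e0 /= wit] : exists2 e : K, 0 < e &
    forall r, 0 < r -> exists p : U * U, dU p.1 p.2 < r /\ e <= dV (f p.1) (f p.2).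
  apply: contrapT => noe; apply: nuf => E; rewrite entV => -[e /= e0 eE].
  have : exists2 r, 0 < r & forall p, dU p.1 p.2 < r -> dV (f p.1) (f p.2) < e.
    apply: contrapT => nor; apply: noe; exists e => // r r0.
    apply: contrapT => nop; apply: nor; exists r => // p pr.
    by rewrite ltNge; apply/negP => pe; apply: nop; exists p.
  move=> [r r0 rP]; rewrite /nbhs/= entU; exists r => //= p pr.
  exact/eE/rP.
have /choice[p pP] : forall n : nat, exists p : U * U,
    dU p.1 p.2 < n.+1%:R^-1 /\ e <= dV (f p.1) (f p.2).
  by move=> n; apply: wit; rewrite invr_gt0.
exists (fun n => (p n).1), (fun n => (p n).2); split; last first.
  by exists e => // n; have [] := pP n.
apply: (@squeeze_cvgr _ _ _ _ (fun=> 0) harmonic).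
- by apply: nearW => n; rewrite dU_ge0 ltW//; have [] := pP n.
- exact: cvg_cst.
- exact: cvg_harmonic.
Qed.

(** * Comparison of a program with its enlargement *)

Lemma quot_map_cls (K : realType) (T : K) (X : causalCore T) (A' A : Type)
    (R' : responseProgram X A') (R : responseProgram X A) :
  (forall x y, resp_congr R' x y -> resp_congr R x y) ->
  forall x, quot_map R' R (cls R' x) = cls R x.
Proof. by move=> R'R x; apply/cls_eq/R'R/cls_eq; exact: reprK. Qed.

Section adjoined_responses.
Context (K : realType) (T : K) (X : causalCore T) (A B : Type).
Variables (R : responseProgram X A) (S : responseProgram X B).
Let Rp := adjoin R S.

Lemma adjoin_congr x y : resp_congr Rp x y -> resp_congr R x y.
Proof. by move=> xy a; exact: (xy (inl a)). Qed.

Lemma adjoin_congr_descends (x y : X) : (forall b, descends R (resp S b)) ->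
  resp_congr R x y -> resp_congr Rp x y.
Proof. by move=> dS xy [a|b]; [exact: xy|exact: dS]. Qed.

Lemma adjoin_quot_map_cls x : quot_map Rp R (cls Rp x) = cls R x.
Proof. exact/quot_map_cls/adjoin_congr. Qed.

Lemma quot_map_adjoin_cls x : (forall b, descends R (resp S b)) ->
  quot_map R Rp (cls R x) = cls Rp x.
Proof. by move=> dS; apply: quot_map_cls => y z; exact: adjoin_congr_descends. Qed.

Lemma quot_map_bij :
  (forall b, descends R (resp S b)) -> bijective (quot_map Rp R).
Proof.
move=> dS; exists (quot_map R Rp) => q; have [x <-] := cls_surj q.
  by rewrite adjoin_quot_map_cls quot_map_adjoin_cls.
by rewrite quot_map_adjoin_cls// adjoin_quot_map_cls.
Qed.

Lemma descended_quot_map (U : Type) (s : X -> U) (q : respQuot Rp) :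
  descends R s -> descended R s (quot_map Rp R q) = descended Rp s q.
Proof. by move=> ds; rewrite descended_cls. Qed.

Lemma quot_map_unif : unif_continuous (quot_map Rp R).
Proof.
apply: respQuot_unif => a.
under eq_fun do rewrite (descended_quot_map _ (@resp_descends _ _ _ _ R a)).
exact: (@descended_resp_unif _ _ _ _ Rp (inl a)).
Qed.

Lemma extends_quot_mapP (f : completion Rp -> completion R) :
  extends_quot_map f <->
  forall x, f (quot_embed (cls Rp x)) = quot_embed (cls R x).
Proof.
split=> [fE x|fE q]; first by rewrite fE adjoin_quot_map_cls.
by have [x <-] := cls_surj q; rewrite fE adjoin_quot_map_cls.
Qed.

Lemma comparison_map_unique (f g : completion Rp -> completion R) :
  unif_continuous f -> extends_quot_map f ->
  unif_continuous g -> extends_quot_map g -> f = g.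
Proof. by move=> uf fE ug gE; apply: eq_on_core => // x; rewrite fE gE. Qed.

Lemma comparison_map_exists : exists Pi : completion Rp -> completion R,
  stable_causal Pi /\ extends_quot_map Pi.
Proof.
have [|a|Pi [[sPi PiE] _]] := @completion_universal _ _ _ _ R (completion Rp)
  (fun x => quot_embed (cls Rp x)) (@dense_quot_embed _ _ _ _ Rp).
- exact: quot_embed_equivariant.
- have [g [[[ug _] gE] _]] := @completion_readout _ _ _ _ Rp (inl a).
  by exists g.
- by exists Pi; split=> //; apply/extends_quot_mapP.
Qed.

Lemma comparison_map_dense (f : completion Rp -> completion R) :
  extends_quot_map f -> dense (range f).
Proof.
move=> /extends_quot_mapP fE O O0 oO.
have [z [Oz [x _ xz]]] := @dense_quot_embed _ _ _ _ R O O0 oO.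
exists z; split=> //; rewrite -xz.
by exists (quot_embed (cls Rp x)).
Qed.

Lemma unif_descended_of_extension (b : B) (Sb : completion R -> cod S b) :
  descends R (resp S b) -> unif_continuous Sb ->
  (forall x, Sb (quot_embed (cls R x)) = resp S b x) ->
  unif_continuous (descended R (resp S b) : respQuot R -> cod S b).
Proof.
move=> dS uS SE.
rewrite (_ : descended _ _ = Sb \o @quot_embed _ _ _ _ R).
  exact: unif_continuous_comp (@quot_embed_unif _ _ _ _ R) uS.
apply/funext => q; have [x <-] := cls_surj q.
by rewrite descended_cls//= SE.
Qed.

(** The enlarged completion has the added response as a coordinate; composing it
    with the inverse of f gives an extension to the old completion. *)
Lemma unif_descended_of_iso (b : B) (f : completion Rp -> completion R) :
  descends R (resp S b) -> extends_quot_map f -> uniform_iso f ->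
  unif_continuous (descended R (resp S b) : respQuot R -> cod S b).
Proof.
move=> dS /extends_quot_mapP fE [_ [g [fK _ ug]]].
have [Sb [[[uS _] SE] _]] := @completion_readout _ _ _ _ Rp (inr b).
apply: (unif_descended_of_extension (Sb := Sb \o g)) => //.
  exact: unif_continuous_comp ug uS.
by move=> x; rewrite /= -fE fK SE.
Qed.

(** One inclusion of uniformities is uniform continuity of the canonical map
    between the quotients and always holds.  The other one is uniform continuity
    of its inverse, which by initiality is that of every old and added response
    for the old uniformity. *)
Lemma entourage_quot_map : (forall b, descends R (resp S b)) ->
  (forall b, unif_continuous
     (descended R (resp S b) : respQuot R -> cod S b)) <->
  @entourage (respQuot R) =
    [set E | @entourage (respQuot Rp)
      [set p | E (quot_map Rp R p.1, quot_map Rp R p.2)]].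
Proof.
move=> dS; split=> [uS|entE b E entbE].
  apply/seteqP; split=> [E|E entE]; first exact: quot_map_unif.
  have uinv : unif_continuous (quot_map R Rp).
    apply: respQuot_unif => -[a|b].
      under eq_fun do rewrite (descended_cls _ (@resp_descends _ _ _ _ Rp (inl a))).
      exact: (@descended_resp_unif _ _ _ _ R a).
    under eq_fun do rewrite (descended_cls _ (@resp_descends _ _ _ _ Rp (inr b))).
    exact: (uS b).
  apply: (@filterS _ (@entourage (respQuot R)) _ _ _ _ (uinv _ entE)) => -[p q].
  have [x <-] := cls_surj p; have [y <-] := cls_surj q.
  by rewrite /= !quot_map_adjoin_cls// !adjoin_quot_map_cls.
rewrite /nbhs/= entE/=.
under eq_set do rewrite !(descended_quot_map _ (dS b)).
exact: (@descended_resp_unif _ _ _ _ Rp (inr b)).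
Qed.

(** The old completion carries all the responses of the enlarged program, so the
    universal property of the enlarged completion gives the inverse map; the
    two composites are identities on the core, hence everywhere. *)
Lemma comparison_map_iso (Pi : completion Rp -> completion R) :
  (forall b, descends R (resp S b)) ->
  (forall b, unif_continuous
     (descended R (resp S b) : respQuot R -> cod S b)) ->
  unif_continuous Pi -> extends_quot_map Pi -> uniform_iso Pi.
Proof.
move=> dS uS uPi /extends_quot_mapP PiE.
have [|i|g [[[ug _] gE] _]] := @completion_universal _ _ _ _ Rp (completion R)
  (fun x => quot_embed (cls R x)) (@dense_quot_embed _ _ _ _ R).
- exact: quot_embed_equivariant.
- case: i => [a|b].
    have [h [[[uh _] hE] _]] := @completion_readout _ _ _ _ R a.
    by exists h.
  have [h [[[uh _] hE] _]] := readout_extension (@cod_complete _ _ _ _ S b)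
    (@resp_equivariant _ _ _ _ S b) (dS b) (uS b).
  by exists h.
have uid (U : uniformType) : unif_continuous (@id U) by move=> E /=; apply: filterS; case.
split=> //; exists g; split=> //.
  have /(congr1 (@^~ _)) gPi : g \o Pi = id; last by move=> z; exact: gPi.
  apply: eq_on_core => [||x] //; first exact: unif_continuous_comp uPi ug.
  by rewrite -[LHS]/(g (Pi _)) PiE gE.
have /(congr1 (@^~ _)) Pig : Pi \o g = id; last by move=> z; exact: Pig.
apply: eq_on_core => [||x] //; first exact: unif_continuous_comp ug uPi.
by rewrite -[LHS]/(Pi (g _)) gE PiE.
Qed.

End adjoined_responses.

Theorem theorem2p14 (K : realType) (T : K) (hT : 0 < T) (X : causalCore T)
    (A B : Type) (R : responseProgram X A) (S : responseProgram X B) :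
  let Rp := adjoin R S in
  (* (i) *)
  ((exists b, ~ descends R (resp S b)) -> strictly_refines Rp R)
  /\
  (* (ii) and (iii) *)
  ((forall b, descends R (resp S b)) ->
    [/\ (forall x y, resp_congr Rp x y <-> resp_congr R x y),
        (forall x, quot_map Rp R (cls Rp x) = cls R x),
        bijective (quot_map Rp R),
        unif_continuous (quot_map Rp R) &
        exists Pi : completion Rp -> completion R,
          [/\ stable_causal Pi,
              extends_quot_map Pi,
              dense (range Pi) &
              forall Pi' : completion Rp -> completion R,
                stable_causal Pi' -> extends_quot_map Pi' -> Pi' = Pi]]
    /\
    (forall Pi : completion Rp -> completion R,
      stable_causal Pi -> extends_quot_map Pi ->
      [<-> (* (a) *)
           forall b, unif_continuous
             (descended R (resp S b) : respQuot R -> cod S b);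
           (* (b) *)
           @entourage (respQuot R) =
             [set E | @entourage (respQuot Rp)
               [set p | E (quot_map Rp R p.1, quot_map Rp R p.2)]];
           (* (c) *)
           [/\ uniform_iso Pi,
               (forall f : completion Rp -> completion R,
                 uniform_iso f -> extends_quot_map f -> f = Pi) &
               forall b, exists! Sb : completion R -> cod S b,
                 stable_causal Sb /\
                 forall x, Sb (quot_embed (cls R x)) = resp S b x]]))
  /\
  (* (iv) *)
  (forall b, descends R (resp S b) ->
    ~ unif_continuous (descended R (resp S b) : respQuot R -> cod S b) ->
    [/\ (* no uniformly continuous extension to the original completion *)
        ~ (exists Sb : completion R -> cod S b,
             unif_continuous Sb /\
             forall x, Sb (quot_embed (cls R x)) = resp S b x),
        (* the refined completion retains the response *)
        (exists! Sb : completion Rp -> cod S b,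
           stable_causal Sb /\
           forall x, Sb (quot_embed (cls Rp x)) = resp S b x),
        (* and is not the original one *)
        (forall f : completion Rp -> completion R,
           extends_quot_map f -> ~ uniform_iso f),
        (* and lies under every causal uniform space, densely spanned by the
           core, that retains all the responses of the enlarged program *)
        (forall (W : causalUniform T) (j : X -> W),
           (forall t, 0 <= t <= T -> forall x, j (ctrunc t x) = trunc t (j x)) ->
           dense (range j) ->
           (forall i, exists g : W -> cod Rp i,
              stable_causal g /\ forall x, g (j x) = resp Rp i x) ->
           exists! h : W -> completion Rp,
             stable_causal h /\ forall x, h (j x) = quot_embed (cls Rp x)) &
        (* the sequential witness in a metrizable presentation *)
        forall (dQ : respQuot R -> respQuot R -> K)
               (dS : cod S b -> cod S b -> K),
          metric_for dQ -> metric_for dS ->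
          exists x y : nat -> X,
            (fun n => dQ (cls R (x n)) (cls R (y n))) @ \oo --> (0 : K) /\
            exists2 e : K, 0 < e &
              forall n, e <= dS (resp S b (x n)) (resp S b (y n))]).
Proof.
move=> Rp; split; last split.
- move=> [b nd]; split=> [x y|]; first exact: adjoin_congr.
  apply: contrapT => nxy; apply: nd => x y xy; apply: contrapT => Sxy.
  by apply: nxy; exists x, y; split=> // /(_ (inr b)).
- move=> dS; split.
    have [Pi [sPi PiE]] := comparison_map_exists R S.
    split.
    + move=> x y; split; first exact: adjoin_congr.
      exact: adjoin_congr_descends.
    + exact: adjoin_quot_map_cls.
    + exact: quot_map_bij.
    + exact: quot_map_unif.
    + exists Pi; split=> //; first exact: comparison_map_dense.
      move=> Pi' [uPi' _] PiE'.
      by apply: comparison_map_unique => //; case: sPi.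
  move=> Pi [uPi _] PiE; tfae.
  + by move/(entourage_quot_map dS).
  + move/(entourage_quot_map dS) => uS; split.
    * exact: comparison_map_iso.
    * by move=> f [uf _] fE; apply: comparison_map_unique.
    * move=> b; apply: readout_extension => //.
      - exact: cod_complete.
      - exact: resp_equivariant.
  + by move=> [iPi _ _] b; exact: unif_descended_of_iso iPi.
- move=> b dS nuS; split.
  + move=> [Sb [uSb SbE]]; apply: nuS.
    exact: unif_descended_of_extension uSb SbE.
  + exact: (@completion_readout _ _ _ _ Rp (inr b)).
  + by move=> f fE fi; apply: nuS; exact: unif_descended_of_iso fi.
  + move=> W j jt dj gex; apply: completion_universal => // i.
    by have [g [[ug _] gE]] := gex i; exists g.
  + move=> dQ dB mQ mB.
    have [p [q [pq0 [e e0 epq]]]] := metric_not_unif_continuous mQ mB nuS.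
    have clsK (r : respQuot R) : cls R (repr r) = r by exact: reprK.
    exists (fun n => repr (p n)), (fun n => repr (q n)); split.
      by under eq_fun do rewrite !clsK.
    by exists e.
Qed.
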